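(* Let $\Omega\subset\mathbb{R}^d$ be an open set, let the density $\rho$ and the stiffness $k$ be constants, let $c:=k^{-1}$ be the compliance, and let $\Delta t$ be the time step. Let $V_{h,0}\subset H_0(\mathrm{grad})$ and $\boldsymbol W_h\subset L^2(\Omega;\mathbb{R}^d)$ be finite element spaces satisfying the compatibility condition $$\boldsymbol W_h\subset\nabla V_{h,0}.$$ Write $f^{n+\frac12}:=\tfrac12(f^{n+1}+f^n)$. Consider the following two schemes. (L) The implicit midpoint scheme for the Lagrangian description, with unknowns $v_{h,L}^n,\,q_{h,L}^n\in V_{h,0}$: $$(\psi_h,\rho(v_{h,L}^{n+1}-v_{h,L}^n))_\Omega=-\Delta t\,(\nabla\psi_h,k\nabla q_{h,L}^{n+\frac12})_\Omega\quad\text{for all }\psi_h\in V_{h,0},$$ $$q_{h,L}^{n+1}-q_{h,L}^n=\Delta t\,v_{h,L}^{n+\frac12}.$$ (M) The implicit midpoint scheme for the mixed formulation, with unknowns $v_{h,M}^n\in V_{h,0}$ and $\boldsymbol\sigma_{h,M}^n\in\boldsymbol W_h$: $$(\psi_h,\rho(v_{h,M}^{n+1}-v_{h,M}^n))_\Omega=-\Delta t\,(\nabla\psi_h,\boldsymbol\sigma_{h,M}^{n+\frac12})_\Omega\quad\text{for all }\psi_h\in V_{h,0},$$ $$(\boldsymbol\xi_h,c(\boldsymbol\sigma_{h,M}^{n+1}-\boldsymbol\sigma_{h,M}^n))_\Omega=\Delta t\,(\boldsymbol\xi_h,\nabla v_{h,M}^{n+\frac12})_\Omega\quad\text{for all }\boldsymbol\xi_h\in\boldsymbol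 W_h.$$ Suppose that $\boldsymbol\sigma_{h,M}^0=k\nabla q_{h,L}^0$ and that the field $q_{h,M}^{n+1}$, with $q_{h,M}^0=q_{h,L}^0$, is reconstructed via the trapezoidal rule $$q_{h,M}^{n+1}=q_{h,M}^n+\frac{\Delta t}{2}\,(v_{h,M}^n+v_{h,M}^{n+1}).$$ Then the formulations (L) and (M) are equivalent.
   Context: The schemes discretize the linear wave equation $\rho\ddot q=\nabla\cdot(k\nabla q)$ with $q|_{\partial\Omega}=0$, where $v=\dot q$ is the velocity and $\boldsymbol\sigma=k\nabla q$ is the stress. $(\cdot,\cdot)_\Omega$ is the $L^2(\Omega)$ inner product of scalar or vector fields. $H_0(\mathrm{grad})$ is the space of $u\in L^2(\Omega)$ with $\nabla u\in L^2$ satisfying the homogeneous Dirichlet condition, and $\nabla V_{h,0}=\{\nabla w: w\in V_{h,0}\}$. A superscript $n$ refers to time $n\Delta t$. The subscripts $L$ and $M$ stand for the Lagrangian and mixed descriptions. Equivalence is meant in the sense that $\boldsymbol\sigma_{h,M}^n=k\nabla q_{h,L}^n$ for all $n$, so that the velocity equations of (L) and (M) are the same, while the update of $q$ is the same by the assumed reconstruction.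
   Formalization: The printed claim fails when W_h is a proper subspace of ∇V_{h,0} or the initial velocities differ; the formal theorem also assumes that k∇q lies in W_h for every q in V_{h,0} (so W_h = ∇V_{h,0}) and v_M^0 = v_L^0, with ρ, k, Δt positive. *)

(* Defs.v *)
From HB Require Import structures.
From mathcomp Require Import all_boot all_order all_algebra.
From mathcomp Require Import all_classical all_reals all_analysis.

Set Implicit Arguments.
Unset Strict Implicit.
Unset Printing Implicit Defensive.
Import Order.TTheory GRing.Theory Num.Theory.
Import numFieldNormedType.Exports.
Local Open Scope classical_set_scope.
Local Open Scope ring_scope.

(* R^d is ['rV[R]_d].  Its sigma-algebra is generated by the coordinate maps;
   it is the Borel sigma-algebra, and the measure below is the restriction of
   the Lebesgue measure to it.  Leaving out the null-set completion does not
   change the L^2 classes. *)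
Definition rV_display : measure_display.
Proof. exact: default_measure_display. Qed.

Section rV_measurable.
Context {R : realType} {d : nat}.

Definition rV_coord (i : 'I_d) (x : 'rV[R]_d) : R := x 0 i.

Let rV_set0 : g_sigma_preimage rV_coord set0.
Proof. exact: sigma_algebra0. Qed.

Let rV_setC A : g_sigma_preimage rV_coord A -> g_sigma_preimage rV_coord (~` A).
Proof. exact: sigma_algebraC. Qed.

Let rV_bigcup (F : _^nat) : (forall i, g_sigma_preimage rV_coord (F i)) ->
  g_sigma_preimage rV_coord (\bigcup_i F i).
Proof. exact: sigma_algebra_bigcup. Qed.

HB.instance Definition _ := @isMeasurable.Build rV_display 'rV[R]_d
  (g_sigma_preimage rV_coord) rV_set0 rV_setC rV_bigcup.

Lemma measurable_rV_coord (i : 'I_d) :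
  measurable_fun [set: 'rV[R]_d] (rV_coord i).
Proof.
move=> _ Y mY; rewrite setTI; apply: sub_sigma_algebra => /=.
rewrite -bigcup_seq/=; exists i => /=; first by rewrite mem_index_enum.
by exists Y => //; rewrite setTI.
Qed.

Lemma measurable_fun_rV d' (T : measurableType d') (f : T -> 'rV[R]_d) :
  (forall i, measurable_fun [set: T] (rV_coord i \o f)) ->
  measurable_fun [set: T] f.
Proof.
move=> mf.
suff : g_sigma_preimage (fun i => rV_coord i \o f) `<=` measurable.
  rewrite g_sigma_preimage_comp => S _ A mA; apply: S; exists A => //.
apply: smallest_sub; first exact: sigma_algebra_measurable.
rewrite -bigcup_seq; apply: bigcup_sub => i _ A [B mB <-].
exact: mf.
Qed.

End rV_measurable.

Section lebesgue_rV_step.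
Context {R : realType} {d : nat}.

Definition rV_cons (p : measurableTypeR R * 'rV[R]_d) : 'rV[R]_d.+1 :=
  \row_i (if unlift ord0 i is Some j then p.2 0 j else p.1 : R).

Definition rV_uncons (x : 'rV[R]_d.+1) : measurableTypeR R * 'rV[R]_d :=
  (x 0 ord0 : R, \row_j x 0 (lift ord0 j)).

Lemma rV_consK : cancel rV_cons rV_uncons.
Proof.
case=> a x; congr pair; rewrite /rV_cons /=; first by rewrite mxE unlift_none.
by apply/rowP => j; rewrite !mxE liftK.
Qed.

Lemma measurable_rV_cons : measurable_fun [set: _] rV_cons.
Proof.
apply: measurable_fun_rV => i; case: (unliftP ord0 i) => [j|] ->.
- rewrite (_ : _ \o _ = rV_coord j \o snd); last first.
    by apply/funext => p; rewrite /rV_coord /= mxE liftK.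
  exact: measurableT_comp (measurable_rV_coord j) measurable_snd.
- rewrite (_ : _ \o _ = (fst : _ -> measurableTypeR R)); last first.
    by apply/funext => p; rewrite /rV_coord /= mxE unlift_none.
  exact: measurable_fst.
Qed.

Lemma measurable_rV_uncons : measurable_fun [set: _] rV_uncons.
Proof.
apply/measurable_fun_pairP; split.
  exact: (measurable_rV_coord ord0).
apply: measurable_fun_rV => j.
rewrite (_ : _ \o _ = rV_coord (lift ord0 j)); last first.
  by apply/funext => x; rewrite /rV_coord /= mxE.
exact: measurable_rV_coord.
Qed.

Variable m : {sigma_finite_measure set 'rV[R]_d -> \bar R}.

Definition lebesgue_rV_step : set 'rV[R]_d.+1 -> \bar R :=
  pushforward (lebesgue_measure \x m)%E rV_cons.

Let pf := measure_function_pushforward__canonical__measure_function_Measure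
  (lebesgue_measure \x m)%E measurable_rV_cons.

HB.instance Definition _ := isMeasure.Build _ _ _ lebesgue_rV_step
  (measure0 pf) (measure_ge0 pf) (@measure_semi_sigma_additive _ _ _ pf).

(* Reproved by hand: the sigma-finiteness instance of product_measure1 is
   shadowed in the library by its subprobability instance. *)
Let lebesgue_rV_step_sigma_finite : sigma_finite setT lebesgue_rV_step.
Proof.
have /sigma_finiteP[F [FT ndF Foo]] := sigma_finiteT (@lebesgue_measure R).
have /sigma_finiteP[G [GT ndG Goo]] := sigma_finiteT m.
have mFG k : measurable (F k `*` G k).
  by apply: measurableX; [exact: (Foo k).1|exact: (Goo k).1].
exists (fun k => rV_uncons @^-1` (F k `*` G k)).
  rewrite -preimage_bigcup (_ : \bigcup_k (F k `*` G k) = setT) ?preimage_setT//.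
  rewrite -subTset => -[a x] _.
  have [i _ Fa] : (\bigcup_k F k) a by rewrite -FT.
  have [j _ Gx] : (\bigcup_k G k) x by rewrite -GT.
  exists (maxn i j) => //; split => /=.
    by move: a Fa; exact/subsetPset/ndF/leq_maxl.
  by move: x Gx; exact/subsetPset/ndG/leq_maxr.
move=> k; split.
  by rewrite -[X in measurable X]setTI; exact: measurable_rV_uncons.
rewrite /lebesgue_rV_step /pushforward -comp_preimage.
rewrite (_ : rV_uncons \o rV_cons = id); last exact/funext/rV_consK.
rewrite preimage_id product_measure1E; [|exact: (Foo k).1|exact: (Goo k).1].
by rewrite lte_mul_pinfty// ?ge0_fin_numE// ?(Foo k).2 ?(Goo k).2.
Qed.

HB.instance Definition _ := Measure_isSigmaFinite.Build _ _ _ lebesgue_rV_step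
  lebesgue_rV_step_sigma_finite.

End lebesgue_rV_step.

Fixpoint lebesgue_rV (R : realType) (d : nat) :
    {sigma_finite_measure set 'rV[R]_d -> \bar R} :=
  if d is d'.+1 then lebesgue_rV_step (lebesgue_rV R d') else \d_(0 : 'rV[R]_0).

Section function_spaces.
Context {R : realType} {d : nat}.
Variable Omega : set 'rV[R]_d.
Local Notation mu := (lebesgue_rV R d).
Implicit Types (f g phi : 'rV[R]_d -> R) (s t : 'rV[R]_d -> 'rV[R]_d).

Definition partial (i : 'I_d) f : 'rV[R]_d -> R :=
  fun x => 'D_(delta_mx 0 i) f x.

Definition iter_partial (l : seq 'I_d) f : 'rV[R]_d -> R := foldr partial f l.

Definition gradient f : 'rV[R]_d -> 'rV[R]_d := fun x => \row_i partial i f x.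

Definition smooth f := forall l : seq 'I_d,
  continuous (iter_partial l f) /\
  (forall i x, derivable (iter_partial l f) x (delta_mx 0 i)).

Definition test_function phi :=
  [/\ smooth phi, compact (closure [set x | phi x != 0]) &
      closure [set x | phi x != 0] `<=` Omega].

Definition L2 f :=
  measurable_fun Omega f /\ mu.-integrable Omega (fun x => (f x ^+ 2)%:E).

Definition L2v s := forall i, L2 (fun x => s x 0 i).

Definition dotv (a b : 'rV[R]_d) : R := \sum_i a 0 i * b 0 i.

Definition ip f g : R := \int[mu]_(x in Omega) (f x * g x).

Definition ipv s t : R := \int[mu]_(x in Omega) dotv (s x) (t x).

Definition weak_gradient f s := forall phi, test_function phi ->
  forall i, ip f (partial i phi) = - ip (fun x => s x 0 i) phi.

(* An element of H_0(grad) is represented by the pair (u, nabla u).  The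
   homogeneous Dirichlet condition means, for an arbitrary open set, that u is
   a limit of test functions in the norm of H(grad). *)
Definition H0_grad (w : ('rV[R]_d -> R) * ('rV[R]_d -> 'rV[R]_d)) :=
  [/\ L2 w.1, L2v w.2, weak_gradient w.1 w.2 &
      forall e : R, 0 < e -> exists2 phi, test_function phi &
        (\int[mu]_(x in Omega) ((w.1 x - phi x) ^+ 2 +
           dotv (w.2 x - gradient phi x) (w.2 x - gradient phi x))%:E
         < e%:E)%E].

(* Equality in H_0(grad).  As weak gradients are unique almost everywhere, the
   second clause is a consequence of the first one on [H0_grad]. *)
Definition H0_eq (w z : ('rV[R]_d -> R) * ('rV[R]_d -> 'rV[R]_d)) :=
  ae_eq mu Omega w.1 z.1 /\ ae_eq mu Omega w.2 z.2.

End function_spaces.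

(* Spans are taken at the level of representatives; every finite-dimensional
   space of L^2 classes is obtained by choosing representatives of a basis. *)
Definition fin_dim_space (R : realType) (M : lmodType R) (V : set M) :=
  exists (n : nat) (b : 'I_n -> M),
    V = [set \sum_(i < n) a i *: b i | a in [set: 'I_n -> R]].

Definition half_step (R : realType) (M : lmodType R) (f : nat -> M) (n : nat) : M :=
  2^-1 *: (f n.+1 + f n).

Section schemes.
Context {R : realType} {d : nat}.
Variable Omega : set 'rV[R]_d.
Variable V : set (('rV[R]_d -> R) * ('rV[R]_d -> 'rV[R]_d)).
Variable W : set ('rV[R]_d -> 'rV[R]_d).
Implicit Types v q : nat -> ('rV[R]_d -> R) * ('rV[R]_d -> 'rV[R]_d).

Definition lagrangian_midpoint (rho k dt : R) v q :=
  [/\ forall n, V (v n) /\ V (q n),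
      forall n psi, V psi ->
        ip Omega psi.1 (rho *: ((v n.+1).1 - (v n).1)) =
        - dt * ipv Omega psi.2 (k *: (half_step q n).2) &
      forall n, H0_eq Omega (q n.+1 - q n) (dt *: half_step v n)].

Definition mixed_midpoint (rho c dt : R) v
    (sigma : nat -> 'rV[R]_d -> 'rV[R]_d) :=
  [/\ forall n, V (v n) /\ W (sigma n),
      forall n psi, V psi ->
        ip Omega psi.1 (rho *: ((v n.+1).1 - (v n).1)) =
        - dt * ipv Omega psi.2 (half_step sigma n) &
      forall n xi, W xi ->
        ipv Omega xi (c *: (sigma n.+1 - sigma n)) =
        dt * ipv Omega xi (half_step v n).2].

End schemes.

(* Main.v *)
Require Import Defs.
From HB Require Import structures.
From mathcomp Require Import all_boot all_order all_algebra.
From mathcomp Require Import all_classical all_reals all_analysis.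
From mathcomp Require Import measurable_realfun ring lra.

Set Implicit Arguments.
Unset Strict Implicit.
Unset Printing Implicit Defensive.
Import Order.TTheory GRing.Theory Num.Theory.
Import numFieldNormedType.Exports.
Local Open Scope classical_set_scope.
Local Open Scope ring_scope.

(** The two schemes agree because their difference solves a midpoint system with
    zero data, and the midpoint rule conserves the energy.

    Proceed by induction on the time step, and assume agreement at step [n].
    Since [k] times the gradient of any element of [V] has a representative in
    [W], the Lagrangian stress at step [n.+1] is almost everywhere equal to some
    [s] in [W].  The gradient of the Lagrangian update of [q] shows that this
    stress satisfies the stress equation of the mixed scheme, so
    the errors [u] (in the velocity) and [tau] (in the stress, taken relative to
    [s]) at step [n.+1] satisfy, for all [psi] in [V] and [xi] in [W],
      rho (psi, u) = - dt / 2 (grad psi, tau),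
      c (xi, tau) = dt / 2 (xi, grad u)
    ([velocity_error] and [stress_error]).

    Taking [psi = u] and [xi = tau] and adding, the right-hand sides cancel:
    rho |u|^2 + c |tau|^2 = 0, hence [u] and [tau] vanish
    ([homogeneous_midpoint_trivial]).  It remains to see that the gradient
    component of [u] vanishes.  Uniqueness of weak gradients is avoided by
    taking for [xi] a representative in [W] of the gradient of [u]: the second
    equation then reads 0 = dt / 2 |grad u|^2.

    Finally the trapezoidal reconstruction is the Lagrangian update of [q], so
    the positions agree as soon as the velocities do. *)

(** * Open sets of R^d are measurable *)

(** An open set is the union of the cubes with rational centre and rational
    radius that it contains; there are countably many of them, and a cube is a
    finite intersection of preimages of intervals by the coordinate maps. *)
Lemma open_measurable_rV (R : realType) (d : nat) (A : set 'rV[R]_d) :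
  open A -> measurable A.
Proof.
move=> oA.
pose box (p : 'rV[rat]_d * rat) : set 'rV[R]_d :=
  \bigcap_(i in [set: 'I_d])
    (rV_coord i @^-1` ball (ratr (p.1 0 i) : R) (ratr p.2)).
have mbox p : measurable (box p).
  apply: fin_bigcap_measurable => // i _.
  rewrite -[X in measurable X]setTI.
  by apply: measurable_rV_coord => //; exact: measurable_ball.
pose F p := if `[< box p `<=` A >] then box p else set0.
rewrite (_ : A = \bigcup_p F p).
  apply: countable_bigcupT_measurable; first exact: countableP.
  by move=> p; rewrite /F; case: ifP.
apply/seteqP; split=> [x Ax|x [p _]]; last first.
  by rewrite /F; case: asboolP => // boxA /boxA.
have /nbhs_ballP[e /= e0 xeA] : nbhs x A by exact: open_nbhs_nbhs.
(* Half of [e]: the centre moves by less than [r], and so do the points. *)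
have /rat_in_itvoo[r] : 0 < e / 2 by lra.
rewrite in_itv/= => /andP[r0 re].
have /choice[q qP] : forall i, exists q : rat, `|ratr q - x 0 i| < ratr r.
  move=> i; have /rat_in_itvoo[q] : x 0 i - ratr r < x 0 i + ratr r by lra.
  by rewrite in_itv/= => /andP[? ?]; exists q; rewrite ltr_norml; apply/andP; split; lra.
exists (\row_i q i, r) => //; rewrite /F asboolT.
  by move=> i _; rewrite /box /= mxE; exact: qP.
move=> y By; apply: xeA; split=> // i j; rewrite ord1.
have := By j I; rewrite /= mxE /rV_coord /ball /= => yq.
rewrite -(subrK (ratr (q j)) (x 0 j)) -addrA; apply: le_lt_trans (ler_normD _ _) _.
by rewrite distrC; have := qP j; lra.
Qed.

(** * The L^2 inner products *)

Section L2_inner_product.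
Context {R : realType} {d : nat} {Omega : set 'rV[R]_d}.
Hypothesis Omega_open : open Omega.
Local Notation mu := (lebesgue_rV R d).
Implicit Types (f g h : 'rV[R]_d -> R) (s t u : 'rV[R]_d -> 'rV[R]_d).

Let mOmega : measurable Omega.
Proof. exact: open_measurable_rV. Qed.

Let linE (a : R) f g x : (a *: f + g) x = a * f x + g x.
Proof. by []. Qed.

(** From the pointwise bound |fg| <= f^2 + g^2. *)
Lemma L2_mul_integrable f g : L2 Omega f -> L2 Omega g ->
  mu.-integrable Omega (fun x => (f x * g x)%:E).
Proof.
move=> [mf If] [mg Ig].
apply: le_integrable (integrableD mOmega If Ig) => //.
  apply/measurable_EFinP; exact: measurable_funM.
move=> x _ /=; rewrite lee_fin [leRHS]ger0_norm ?addr_ge0 ?sqr_ge0//.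
by rewrite ler_norml; apply/andP; split; nra.
Qed.

Lemma L2_lin (a : R) f g : L2 Omega f -> L2 Omega g -> L2 Omega (a *: f + g).
Proof.
move=> Lf Lg; split.
  apply: measurable_funD; last exact: Lg.1.
  by apply: measurable_funM; [exact: measurable_cst|exact: Lf.1].
have := integrableD mOmega (integrableZl mOmega (a ^+ 2) Lf.2)
  (integrableD mOmega (integrableZl mOmega (a *+ 2) (L2_mul_integrable Lf Lg)) Lg.2).
apply: eq_integrable => // x _ /=; congr EFin.
by rewrite linE; ring.
Qed.

Lemma ip_lin (a : R) f g h : L2 Omega f -> L2 Omega g -> L2 Omega h ->
  ip Omega h (a *: f + g) = a * ip Omega h f + ip Omega h g.
Proof.
move=> Lf Lg Lh; rewrite /ip -RintegralZl//; last exact: L2_mul_integrable.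
rewrite -RintegralD//; first last.
- exact: L2_mul_integrable.
- exact: (integrableZl mOmega a (L2_mul_integrable Lh Lf)).
by apply: eq_Rintegral => x _; rewrite linE; ring.
Qed.

Lemma ip_ge0 f : 0 <= ip Omega f f.
Proof. by apply: Rintegral_ge0 => x _; rewrite -expr2 sqr_ge0. Qed.

Lemma ip_eq0 f : L2 Omega f -> ip Omega f f = 0 -> ae_eq mu Omega f 0.
Proof.
move=> Lf f0; have If := L2_mul_integrable Lf Lf.
have /(ae_eq_integral_abs mu mOmega (measurable_int _ If)) :
    (\int[mu]_(x in Omega) `|(f x * f x)%:E| = 0)%E.
  under eq_integral do rewrite gee0_abs ?lee_fin -?expr2 ?sqr_ge0//.
  by rewrite -[LHS]fineK ?(integrable_fin_num mOmega Lf.2)//; congr EFin; exact: f0.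
apply: filterS => x /[apply] -[] /eqP.
by rewrite mulf_eq0 orbb => /eqP.
Qed.

Lemma ip_ae_eq f g h : L2 Omega f -> L2 Omega g -> L2 Omega h ->
  ae_eq mu Omega f g -> ip Omega h f = ip Omega h g.
Proof.
move=> Lf Lg Lh fg; congr fine; apply: ae_eq_integral => //.
- exact: measurable_int (L2_mul_integrable Lh Lf).
- exact: measurable_int (L2_mul_integrable Lh Lg).
- by apply: filterS fg => x /[apply] ->.
Qed.

Lemma L2v_lin (a : R) s t : L2v Omega s -> L2v Omega t -> L2v Omega (a *: s + t).
Proof.
move=> Ls Lt i; rewrite (_ : (fun _ => _) = a *: (fun x => s x 0 i) + (fun x => t x 0 i)).
  exact: L2_lin.
by apply/funext => x; rewrite !fctE !mxE.
Qed.

(** Reduces linearity, definiteness and invariance under almost everywhere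
    equality to the scalar case, one coordinate at a time. *)
Lemma ipv_sum s t : L2v Omega s -> L2v Omega t ->
  ipv Omega s t = \sum_i ip Omega (fun x => s x 0 i) (fun x => t x 0 i).
Proof.
move=> Ls Lt; rewrite /ipv /dotv /Rintegral.
under eq_integral do rewrite -sumEFin.
rewrite integral_sum//; last by move=> i; exact: L2_mul_integrable.
rewrite sum_fine// => i _.
by apply: integrable_fin_num => //; exact: L2_mul_integrable.
Qed.

Lemma ipv_lin (a : R) s t u : L2v Omega s -> L2v Omega t -> L2v Omega u ->
  ipv Omega u (a *: s + t) = a * ipv Omega u s + ipv Omega u t.
Proof.
move=> Ls Lt Lu; rewrite !ipv_sum//; last exact: L2v_lin.
rewrite mulr_sumr -big_split; apply: eq_bigr => i _ /=.
rewrite -ip_lin//; congr ip.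
by apply/funext => x; rewrite !fctE !mxE.
Qed.

Lemma ipvC s t : ipv Omega s t = ipv Omega t s.
Proof.
by apply: eq_Rintegral => x _; apply: eq_bigr => i _; rewrite mulrC.
Qed.

Lemma ipv_ge0 s : 0 <= ipv Omega s s.
Proof.
by apply: Rintegral_ge0 => x _; apply: sumr_ge0 => i _; rewrite -expr2 sqr_ge0.
Qed.

Lemma ipv_eq0 s : L2v Omega s -> ipv Omega s s = 0 -> ae_eq mu Omega s 0.
Proof.
move=> Ls; rewrite ipv_sum// => /eqP; rewrite psumr_eq0; last first.
  by move=> i _; exact: ip_ge0.
move=> /allP s0.
have : \forall x \ae mu, forall i, Omega x -> s x 0 i = 0.
  apply: filter_forall => i; apply: ip_eq0 => //.
  by apply/eqP/s0; rewrite mem_index_enum.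
by apply: filterS => x sx Ox; apply/rowP => i; rewrite sx// mxE.
Qed.

Lemma ipv_ae_eq s t u : L2v Omega s -> L2v Omega t -> L2v Omega u ->
  ae_eq mu Omega s t -> ipv Omega u s = ipv Omega u t.
Proof.
move=> Ls Lt Lu st; rewrite !ipv_sum//; apply: eq_bigr => i _.
by apply: ip_ae_eq => //; apply: filterS st => x /[apply] ->.
Qed.

Lemma ipZ (a : R) f h : L2 Omega f -> L2 Omega h ->
  ip Omega h (a *: f) = a * ip Omega h f.
Proof.
move=> Lf Lh; rewrite -[a](subrK 1) scalerDl scale1r ip_lin//; ring.
Qed.

Lemma ipvZ (a : R) s u : L2v Omega s -> L2v Omega u ->
  ipv Omega u (a *: s) = a * ipv Omega u s.
Proof.
move=> Ls Lu; rewrite -[a](subrK 1) scalerDl scale1r ipv_lin//; ring.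
Qed.

Lemma L2Z (a : R) f : L2 Omega f -> L2 Omega (a *: f).
Proof.
by move=> Lf; rewrite -[a](subrK 1) scalerDl scale1r; exact: L2_lin.
Qed.

Lemma L2vZ (a : R) s : L2v Omega s -> L2v Omega (a *: s).
Proof.
by move=> Ls; rewrite -[a](subrK 1) scalerDl scale1r; exact: L2v_lin.
Qed.

Lemma L2B f g : L2 Omega f -> L2 Omega g -> L2 Omega (f - g).
Proof. by move=> Lf Lg; rewrite addrC -scaleN1r; exact: L2_lin. Qed.

Lemma L2vB s t : L2v Omega s -> L2v Omega t -> L2v Omega (s - t).
Proof. by move=> Ls Lt; rewrite addrC -scaleN1r; exact: L2v_lin. Qed.

Lemma L2v_half_step (s : nat -> 'rV[R]_d -> 'rV[R]_d) n :
  (forall m, L2v Omega (s m)) -> L2v Omega (half_step s n).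
Proof.
move=> Ls; apply: L2vZ; rewrite -[s n.+1]scale1r; exact: L2v_lin.
Qed.

End L2_inner_product.

(** * Linear closure of finite-dimensional spaces *)

Lemma fin_dim_space_lin (R : realType) (M : lmodType R) (V : set M) (a : R) x y :
  fin_dim_space V -> V x -> V y -> V (a *: x + y).
Proof.
move=> [n [b ->]] [ax _ <-] [ay _ <-]; exists (fun i => a * ax i + ay i) => //.
rewrite scaler_sumr -big_split; apply: eq_bigr => i _.
by rewrite scalerDl scalerA.
Qed.

Lemma fin_dim_spaceB (R : realType) (M : lmodType R) (V : set M) x y :
  fin_dim_space V -> V x -> V y -> V (x - y).
Proof.
by move=> fV Vx Vy; rewrite addrC -scaleN1r; exact: fin_dim_space_lin.
Qed.

Lemma fin_dim_spaceZ (R : realType) (M : lmodType R) (V : set M) (a : R) x :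
  fin_dim_space V -> V x -> V (a *: x).
Proof.
move=> fV Vx; rewrite -[a](subrK 1) scalerDl scale1r.
exact: fin_dim_space_lin.
Qed.

(** * The error between the two schemes *)

Section midpoint_error.
Context {R : realType} {d : nat} {Omega : set 'rV[R]_d}.
Variable V : set (('rV[R]_d -> R) * ('rV[R]_d -> 'rV[R]_d)).
Variable W : set ('rV[R]_d -> 'rV[R]_d).
Hypothesis Omega_open : open Omega.
Hypotheses (V_sub : V `<=` H0_grad Omega) (W_sub : W `<=` L2v Omega).
Local Notation mu := (lebesgue_rV R d).

Let V_L2 w : V w -> L2 Omega w.1.
Proof. by move=> /V_sub[]. Qed.

Let V_L2v w : V w -> L2v Omega w.2.
Proof. by move=> /V_sub[]. Qed.

(** Energy argument: testing with [u] and [tau] themselves makes the coupling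
    terms cancel by symmetry of the inner product.  The hypothesis on gradients
    makes the gradient of [u] an admissible test field, which gives its
    vanishing directly from the stress equation. *)
Lemma homogeneous_midpoint_trivial (rho c dt : R) u tau :
  (forall w, V w -> exists2 s, W s & ae_eq mu Omega s w.2) ->
  0 < rho -> 0 < c -> 0 < dt -> V u -> W tau ->
  (forall psi, V psi -> ip Omega psi.1 (rho *: u.1) =
     - dt * ipv Omega psi.2 (2^-1 *: tau)) ->
  (forall xi, W xi -> ipv Omega xi (c *: tau) =
     dt * ipv Omega xi (2^-1 *: u.2)) ->
  H0_eq Omega u 0 /\ ae_eq mu Omega tau 0.
Proof.
move=> grad_in_W rho0 c0 dt0 Vu Wtau velocity stress.
have Lu1 := V_L2 Vu; have Lu2 := V_L2v Vu; have Ltau := W_sub Wtau.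
have := velocity _ Vu; have := stress _ Wtau.
rewrite ipZ// !ipvZ// (ipvC tau) => stressE velocityE.
have u0 := ip_ge0 (Omega := Omega) u.1.
have tau0 := ipv_ge0 (Omega := Omega) tau.
have /ipv_eq0-/(_ Omega_open Ltau) tau_eq0 : ipv Omega tau tau = 0 by nra.
have /ip_eq0-/(_ Omega_open Lu1) u1_eq0 : ip Omega u.1 u.1 = 0 by nra.
(* As [tau] vanishes, the stress equation says that the gradient of [u] is
   orthogonal to [W], to which it belongs through its representative [s]. *)
split=> //; split=> //; have [s Ws su2] := grad_in_W _ Vu.
have Ls := W_sub Ws.
apply: ipv_eq0 => //; rewrite -(ipv_ae_eq _ _ _ _ su2)// ipvC.
have := stress _ Ws; rewrite !ipvZ//.
rewrite (@ipv_ae_eq _ _ _ Omega_open _ (0 *: tau)) ?ipvZ//; first by nra.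
  exact: L2vZ.
by rewrite scale0r.
Qed.

Variables (rho k dt : R).
Variables (vL qL vM : nat -> ('rV[R]_d -> R) * ('rV[R]_d -> 'rV[R]_d)).
Variable sigma : nat -> 'rV[R]_d -> 'rV[R]_d.
Hypothesis k_neq0 : k != 0.
Hypothesis schemeL : lagrangian_midpoint Omega V rho k dt vL qL.
Hypothesis schemeM : mixed_midpoint Omega V W rho k^-1 dt vM sigma.
(** [s] stands for the Lagrangian stress at step [n.+1]; taking it in [W] keeps
    the stress error in [W], where it can serve as a test field. *)
Variables (n : nat) (s : 'rV[R]_d -> 'rV[R]_d).
Hypothesis sigma_n : ae_eq mu Omega (sigma n) (k *: (qL n).2).
Hypothesis v_n : H0_eq Omega (vM n) (vL n).
Hypothesis Ws : W s.
Hypothesis s_grad : ae_eq mu Omega s (k *: (qL n.+1).2).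

Let LvL1 m : L2 Omega (vL m).1.
Proof. by case: schemeL => /(_ m)[/V_L2]. Qed.

Let LvL2 m : L2v Omega (vL m).2.
Proof. by case: schemeL => /(_ m)[/V_L2v]. Qed.

Let LqL2 m : L2v Omega (qL m).2.
Proof. by case: schemeL => /(_ m)[_ /V_L2v]. Qed.

Let LvM1 m : L2 Omega (vM m).1.
Proof. by case: schemeM => /(_ m)[/V_L2]. Qed.

Let LvM2 m : L2v Omega (vM m).2.
Proof. by case: schemeM => /(_ m)[/V_L2v]. Qed.

Let Lsigma m : L2v Omega (sigma m).
Proof. by case: schemeM => /(_ m)[_ /W_sub]. Qed.

Let Ls : L2v Omega s.
Proof. exact: W_sub. Qed.

(** Both velocity equations are the same equation driven by different stresses,
    and the stresses agree at step [n]: the midpoint average only keeps half of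
    the difference at step [n.+1]. *)
Lemma velocity_error psi : V psi ->
  ip Omega psi.1 (rho *: (vM n.+1 - vL n.+1).1) =
  - dt * ipv Omega psi.2 (2^-1 *: (sigma n.+1 - s)).
Proof.
move=> Vpsi; have Lpsi1 := V_L2 Vpsi; have Lpsi2 := V_L2v Vpsi.
have [_ velL _] := schemeL; have [_ velM _] := schemeM.
have LdL : L2 Omega (rho *: ((vL n.+1).1 - (vL n).1)).
  by apply: L2Z => //; exact: L2B.
have LdM : L2 Omega (rho *: ((vM n.+1).1 - (vM n).1)).
  by apply: L2Z => //; exact: L2B.
have LhL : L2v Omega (k *: (half_step qL n).2).
  by apply: L2vZ => //; exact: (@L2v_half_step _ _ _ Omega_open (fun m => (qL m).2)).
have LhM : L2v Omega (half_step sigma n) by exact: L2v_half_step.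
rewrite (@ip_ae_eq _ _ _ Omega_open _ (-1 *: (rho *: ((vL n.+1).1 - (vL n).1)) +
    rho *: ((vM n.+1).1 - (vM n).1)))//; first last.
- apply: filterS v_n.1 => x /[apply] e.
  change (rho * ((vM n.+1).1 x - (vL n.+1).1 x) =
    -1 * (rho * ((vL n.+1).1 x - (vL n).1 x)) +
    rho * ((vM n.+1).1 x - (vM n).1 x)).
  rewrite e; ring.
- exact: L2_lin.
- by apply: L2Z => //; exact: L2B.
rewrite ip_lin// velL// velM//; transitivity (- dt *
  (-1 * ipv Omega psi.2 (k *: (half_step qL n).2) +
   ipv Omega psi.2 (half_step sigma n))); first by ring.
rewrite -ipv_lin//; congr (_ * _).
apply: ipv_ae_eq => //.
- exact: L2v_lin.
- by apply: L2vZ => //; exact: L2vB.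
apply: filterS2 sigma_n s_grad => x e1 e2 Ox.
change (-1 *: (k *: (2^-1 *: ((qL n.+1).2 x + (qL n).2 x))) +
  2^-1 *: (sigma n.+1 x + sigma n x) = 2^-1 *: (sigma n.+1 x - s x)).
rewrite e1// e2//; apply/rowP => i; rewrite !mxE; ring.
Qed.

(** The gradient of the position update says that the Lagrangian stress [k grad q]
    moves by [k dt] times the gradient of the midpoint velocity, pointwise
    almost everywhere; this is a strong form of the mixed stress equation, from
    which it is subtracted. *)
Lemma stress_error xi : W xi ->
  ipv Omega xi (k^-1 *: (sigma n.+1 - s)) =
  dt * ipv Omega xi (2^-1 *: (vM n.+1 - vL n.+1).2).
Proof.
move=> Wxi; have Lxi := W_sub Wxi.
have [_ _ updL] := schemeL; have [_ _ strM] := schemeM.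
have LhL : L2v Omega (half_step vL n).2.
  exact: (@L2v_half_step _ _ _ Omega_open (fun m => (vL m).2)).
have LhM : L2v Omega (half_step vM n).2.
  exact: (@L2v_half_step _ _ _ Omega_open (fun m => (vM m).2)).
have LdM : L2v Omega (k^-1 *: (sigma n.+1 - sigma n)).
  by apply: L2vZ => //; exact: L2vB.
rewrite (@ipv_ae_eq _ _ _ Omega_open _ (- dt *: (half_step vL n).2 +
    k^-1 *: (sigma n.+1 - sigma n)))//; first last.
- apply: filterS3 sigma_n s_grad (updL n).2 => x e1 e2 e3 Ox.
  have {}e3 : (qL n.+1).2 x - (qL n).2 x =
    dt *: (2^-1 *: ((vL n.+1).2 x + (vL n).2 x)) := e3 Ox.
  change (k^-1 *: (sigma n.+1 x - s x) =
    - dt *: (2^-1 *: ((vL n.+1).2 x + (vL n).2 x)) +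
    k^-1 *: (sigma n.+1 x - sigma n x)).
  rewrite scaleNr -e3 e1// e2//; apply/rowP => i; by rewrite !mxE; field.
- exact: L2v_lin.
- by apply: L2vZ => //; exact: L2vB.
rewrite ipv_lin// strM//; transitivity (dt *
  (-1 * ipv Omega xi (half_step vL n).2 + ipv Omega xi (half_step vM n).2)).
  by ring.
rewrite -ipv_lin//; congr (_ * _); apply: ipv_ae_eq => //.
- exact: L2v_lin.
- by apply: L2vZ => //; exact: L2vB.
apply: filterS v_n.2 => x /[apply] e.
change (-1 *: (2^-1 *: ((vL n.+1).2 x + (vL n).2 x)) +
  2^-1 *: ((vM n.+1).2 x + (vM n).2 x) = 2^-1 *: ((vM n.+1).2 x - (vL n.+1).2 x)).
rewrite e; apply/rowP => i; rewrite !mxE; ring.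
Qed.

End midpoint_error.

Theorem proposition2 (R : realType) (d : nat) (Omega : set 'rV[R]_d)
  (rho k dt : R)
  (V : set (('rV[R]_d -> R) * ('rV[R]_d -> 'rV[R]_d)))
  (W : set ('rV[R]_d -> 'rV[R]_d))
  (vL qL vM qM : nat -> ('rV[R]_d -> R) * ('rV[R]_d -> 'rV[R]_d))
  (sigmaM : nat -> 'rV[R]_d -> 'rV[R]_d)
  (Omega_open : open Omega)
  (rho_gt0 : 0 < rho) (k_gt0 : 0 < k) (dt_gt0 : 0 < dt)
  (V_fin : fin_dim_space V) (V_sub : V `<=` H0_grad Omega)
  (W_fin : fin_dim_space W) (W_sub : W `<=` L2v Omega)
  (compatibility : forall s, W s ->
     exists2 w, V w & ae_eq (lebesgue_rV R d) Omega s w.2)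
  (initialisation : forall q0, V q0 ->
     exists2 s0, W s0 & ae_eq (lebesgue_rV R d) Omega s0 (k *: q0.2))
  (schemeL : lagrangian_midpoint Omega V rho k dt vL qL)
  (schemeM : mixed_midpoint Omega V W rho k^-1 dt vM sigmaM)
  (v0 : H0_eq Omega (vM 0%N) (vL 0%N))
  (sigma0 : ae_eq (lebesgue_rV R d) Omega (sigmaM 0%N) (k *: (qL 0%N).2))
  (q0 : H0_eq Omega (qM 0%N) (qL 0%N))
  (reconstruction : forall n,
     H0_eq Omega (qM n.+1) (qM n + (dt / 2) *: (vM n + vM n.+1))) :
  forall n,
    [/\ ae_eq (lebesgue_rV R d) Omega (sigmaM n) (k *: (qL n).2),
        H0_eq Omega (vM n) (vL n) &
        H0_eq Omega (qM n) (qL n)].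
Proof.
have [VL _ updL] := schemeL; have [VM _ _] := schemeM.
have k_neq0 : k != 0 by rewrite gt_eqF.
have grad_in_W w : V w ->
    exists2 s, W s & ae_eq (lebesgue_rV R d) Omega s w.2.
  move=> /initialisation[s Ws sw]; exists (k^-1 *: s).
    exact: fin_dim_spaceZ.
  apply: filterS sw => x /[apply] e.
  by rewrite /= fctE e scalerA mulVf// scale1r.
elim=> [|n [sigman vn qn]]; first by split.
have [s Ws sq] := initialisation _ (VL n.+1).2.
have [u0 tau0] : H0_eq Omega (vM n.+1 - vL n.+1) 0 /\
    ae_eq (lebesgue_rV R d) Omega (sigmaM n.+1 - s) 0.
  apply: (homogeneous_midpoint_trivial Omega_open V_sub W_sub grad_in_W
    rho_gt0 (c := k^-1) _ dt_gt0).
  - by rewrite invr_gt0.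
  - exact: fin_dim_spaceB (VM n.+1).1 (VL n.+1).1.
  - exact: fin_dim_spaceB (VM n.+1).2 Ws.
  - exact: (velocity_error Omega_open V_sub W_sub schemeL schemeM sigman vn Ws sq).
  - exact: (stress_error Omega_open V_sub W_sub k_neq0 schemeL schemeM sigman vn
      Ws sq).
have vn1 : H0_eq Omega (vM n.+1) (vL n.+1).
  by split; [apply: filterS u0.1|apply: filterS u0.2] => x /[apply] /subr0_eq.
split=> //.
  apply: filterS2 tau0 sq => x e1 e2 Ox.
  by rewrite -e2//; apply/subr0_eq; exact: e1.
have trapezoid (U : lmodType R) (qM1 qM0 vM0 vM1 qL1 qL0 vL0 vL1 : U) :
    qM1 = qM0 + (dt / 2) *: (vM0 + vM1) ->
    qL1 - qL0 = dt *: (2^-1 *: (vL1 + vL0)) ->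
    qM0 = qL0 -> vM0 = vL0 -> vM1 = vL1 -> qM1 = qL1.
  move=> -> e -> -> ->.
  by rewrite -scalerA [vL0 + _]addrC -e addrC subrK.
split.
- apply: filterS3 (filterI vn.1 vn1.1) (filterI qn.1 (updL n).1)
    (reconstruction n).1 => x [ev ev1] [eq eL] eM Ox.
  exact: trapezoid (eM Ox) (eL Ox) (eq Ox) (ev Ox) (ev1 Ox).
- apply: filterS3 (filterI vn.2 vn1.2) (filterI qn.2 (updL n).2)
    (reconstruction n).2 => x [ev ev1] [eq eL] eM Ox.
  exact: trapezoid (eM Ox) (eL Ox) (eq Ox) (ev Ox) (ev1 Ox).
Qed.
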